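(* Let $(A,\circ_A)$ be an anti-pre-Lie algebra and let $(A^*,\circ_{A^*})$ be an anti-pre-Lie algebra structure on the dual space $A^*$. Let $(\mathfrak g(A),[-,-]_A)$ and $(\mathfrak g(A^* ),[-,-]_{A^*})$ be their sub-adjacent Lie algebras. Then the following conditions are equivalent: (1) There is a Manin triple $\big((\mathfrak g(A)\oplus\mathfrak g(A^* ),[-,-],\mathcal B_d),\mathfrak g(A),\mathfrak g(A^* )\big)$ of Lie algebras with respect to the commutative 2-cocycle such that the compatible anti-pre-Lie algebra $(A\oplus A^*,\circ)$ defined by $\mathcal B_d(u\circ v,w)=\mathcal B_d(v,[u,w])$ for all $u,v,w\in A\oplus A^*$ contains $(A,\circ_A)$ and $(A^*,\circ_{A^*})$ as anti-pre-Lie subalgebras. (2) $(A,A^*,-\mathrm{ad}_A^*,\mathcal R^*_{\circ_A},-\mathrm{ad}^*_{A^*},\mathcal R^*_{\circ_{A^*}})$ is a matched pair of anti-pre-Lie algebras. (3) $(\mathfrak g(A),\mathfrak g(A^* ),-\mathcal L^*_{\circ_A},-\mathcal L^*_{\circ_{A^*}})$ is a matched pair of Lie algebras. Moreover, every Manin triple of Lie algebras with respect to the commutative 2-cocycle can be obtained this way, that is, it is the Manin triple in (1) for suitable anti-pre-Lie algebra structures on the two given dual spaces whose sub-adjacent Lie algebras are the two given Lie algebras.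
   Context: All vector spaces and algebras are finite-dimensional over an algebraically closed field $\mathbb K$ of characteristic zero. Anti-pre-Lie algebra: a vector space $A$ with a bilinear operation $\circ$ such that, with $[x,y]=x\circ y-y\circ x$, for all $x,y,z$: $x\circ(y\circ z)-y\circ(x\circ z)=[y,x]\circ z$ and $[x,y]\circ z+[y,z]\circ x+[z,x]\circ y=0$. Then $[-,-]$ is a Lie bracket; $(\mathfrak g(A),[-,-])$ is the sub-adjacent Lie algebra and $\circ$ is called compatible with it. Notation: $\mathcal L_\circ(x)y=x\circ y=\mathcal R_\circ(y)x$, $\mathrm{ad}(x)y=[x,y]$; subscripts $A$, $A^*$ indicate the algebra. For a linear map $\rho:A\to\mathrm{End}(V)$, $\rho^*:A\to\mathrm{End}(V^* )$ is defined by $\langle\rho^*(x)u^*,v\rangle=-\langle u^*,\rho(x)v\rangle$. A commutative 2-cocycle on a Lie algebra is a symmetric bilinear form $\mathcal B$ with $\mathcal B([x,y],z)+\mathcal B([y,z],x)+\mathcal B([z,x],y)=0$. It is known that if $\mathcal B$ is a nondegenerate commutative 2-cocycle on a Lie algebra $(\mathfrak g,[-,-])$, there is a unique compatible anti-pre-Lie algebra structure $\circ$ on it with $\mathcal B(x\circ y,z)=\mathcal B(y,[x,z])$. Manin triple of Lie algebras with respect to the commutative 2-cocycle, $((\mathfrak g\oplus\mathfrak g^*,[-,-],\mathcal B_d),\mathfrak g,\mathfrak g^* )$: Lie algebra structures on $\mathfrak g$, $\mathfrak g^*$ and $\mathfrak g\oplus\mathfrak g^*$ such that $\mathfrak g$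 and $\mathfrak g^*$ are Lie subalgebras of $\mathfrak g\oplus\mathfrak g^*$ and the form $\mathcal B_d(x+a^*,y+b^* )=\langle x,b^*\rangle+\langle a^*,y\rangle$ is a commutative 2-cocycle on $\mathfrak g\oplus \mathfrak g^*$. Matched pair of Lie algebras $(\mathfrak g,\mathfrak h,\rho_{\mathfrak g},\rho_{\mathfrak h})$: $\rho_{\mathfrak g}:\mathfrak g\to\mathfrak{gl}(\mathfrak h)$ and $\rho_{\mathfrak h}:\mathfrak h\to\mathfrak{gl}(\mathfrak g)$ are representations such that for $x,y\in\mathfrak g$, $a,b\in\mathfrak h$: $\rho_{\mathfrak g}(x)[a,b]-[\rho_{\mathfrak g}(x)a,b]-[a,\rho_{\mathfrak g}(x)b]+\rho_{\mathfrak g}(\rho_{\mathfrak h}(a)x)b-\rho_{\mathfrak g}(\rho_{\mathfrak h}(b)x)a=0$, $\rho_{\mathfrak h}(a)[x,y]-[\rho_{\mathfrak h}(a)x,y]-[x,\rho_{\mathfrak h}(a)y]+\rho_{\mathfrak h}(\rho_{\mathfrak g}(x)a)y-\rho_{\mathfrak h}(\rho_{\mathfrak g}(y)a)x=0$. Representation $(l,r,V)$ of an anti-pre-Lie algebra $(A,\circ)$: linear maps $l,r:A\to\mathrm{End}(V)$ with, for all $x,y\in A$, $l(y\circ x)-l(x\circ y)=l(x)l(y)-l(y)l(x)$; $r(x\circ y)=l(x)r(y)+r(y)l(x)-r(y)r(x)$; $l(y\circ x)-l(x\circ y)=r(x)l(y)-r(y)l(x)-r(x)r(y)+r(y)r(x)$.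 Matched pair of anti-pre-Lie algebras $(A,B,l_A,r_A,l_B,r_B)$: $(A,\circ_A)$, $(B,\circ_B)$ are anti-pre-Lie algebras, $(l_A,r_A,B)$ is a representation of $A$, $(l_B,r_B,A)$ is a representation of $B$, and for all $x,y\in A$, $a\in B$: (i) $r_B(l_A(y)a)x+x\circ_A r_B(a)y-r_B(l_A(x)a)y-y\circ_A r_B(a)x=r_B(a)([y,x]_A)$; (ii) $x\circ_A l_B(a)y+r_B(r_A(y)a)x-l_B(a)(x\circ_A y)=\big((l_B-r_B)(a)x\big)\circ_A y+l_B((r_A-l_A)(x)a)y$; (iii) $r_B(a)([x,y]_A)=\big((l_B-r_B)(a)y\big)\circ_A x+\big((r_B-l_B)(a)x\big)\circ_A y+l_B((r_A-l_A)(y)a)x+l_B((l_A-r_A)(x)a)y$; together with the three equations obtained from (i)–(iii) by exchanging the roles of $A$ and $B$ (replacing $x,y\in A$, $a\in B$ by $a,b\in B$, $x\in A$). *)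

(* Defs.v *)
From HB Require Import structures.
From mathcomp Require Import all_boot all_algebra.

Set Implicit Arguments.
Unset Strict Implicit.
Unset Printing Implicit Defensive.

Import GRing.Theory.
Local Open Scope ring_scope.

(* The dual space; the pairing of u : dual V with x : V is u x. *)
Notation dual V := 'Hom(V, _^o).

(* A bilinear map U x V -> W is encoded as an element of 'Hom(U, 'Hom(V, W));
   in particular a bilinear operation on A is an element mu : 'Hom(A, 'End(A)),
   whose value at x and y is mu x y, and mu x is the left multiplication. *)
Notation bilop A := 'Hom(A, 'End(A)).

(* The intended value is bilin f x y = f x y; bilinE gives it for bilinear f. *)
Definition bilin (K : fieldType) (U V W : vectType K) (f : U -> V -> W) :
  'Hom(U, 'Hom(V, W)) := linfun (fun x => linfun (f x)).

Lemma bilinE (K : fieldType) (U V W : vectType K) (f : U -> V -> W) :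
  (forall y, linear (f^~ y)) -> (forall x, linear (f x)) ->
  forall x y, bilin f x y = f x y.
Proof.
move=> fl fr x y.
have E2 u v : linfun (f u) v = f u v.
  pose fS := GRing.isLinear.Build K V W *:%R (f u) (fr u).
  pose ff : {linear V -> W} := HB.pack (f u) fS.
  exact: (lfunE ff v).
have L1 : linear (fun u => linfun (f u)).
  by move=> k u v; apply/lfunP => z; rewrite add_lfunE scale_lfunE !E2 fl.
pose gS := GRing.isLinear.Build K U 'Hom(V, W) *:%R (fun u => linfun (f u)) L1.
pose gg : {linear U -> 'Hom(V, W)} := HB.pack (fun u => linfun (f u)) gS.
by rewrite /bilin (lfunE gg x) /= E2.
Qed.

Section Operations.
Variables (K : fieldType) (A : vectType K).
Implicit Type mu : bilop A.

Definition Lmul mu : bilop A := mu.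

Definition Rmul mu : bilop A := bilin (fun y x => mu x y).

Definition commutator mu : bilop A := mu - Rmul mu.

Lemma RmulE mu x y : Rmul mu y x = mu x y.
Proof.
rewrite /Rmul bilinE // => z k u v; first exact: linearP.
by rewrite linearP /= add_lfunE scale_lfunE.
Qed.

Lemma commutatorE mu x y : commutator mu x y = mu x y - mu y x.
Proof. by rewrite /commutator !add_lfunE !opp_lfunE RmulE. Qed.

Definition anti_pre_lie mu : Prop :=
  (forall x y z, mu x (mu y z) - mu y (mu x z) = mu (commutator mu y x) z) /\
  (forall x y z, mu (commutator mu x y) z + mu (commutator mu y z) x
                 + mu (commutator mu z x) y = 0).

Definition lie_bracket (br : bilop A) : Prop :=
  (forall x, br x x = 0) /\
  (forall x y z, br x (br y z) + br y (br z x) + br z (br x y) = 0).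

Definition commutative_2cocycle (br : bilop A) (B : A -> A -> K) : Prop :=
  [/\ bilinear_for *%R *%R B,
      forall x y, B x y = B y x &
      forall x y z, B (br x y) z + B (br y z) x + B (br z x) y = 0].

(* For nondegenerate B, the last clause determines mu. *)
Definition compatible_anti_pre_lie (br : bilop A) (B : A -> A -> K) mu : Prop :=
  [/\ anti_pre_lie mu,
      commutator mu = br &
      forall x y z, B (mu x y) z = B y (br x z)].

End Operations.

Section Representations.
Variable K : fieldType.
Implicit Types V W : vectType K.

(* rho^* : W -> End(V^* ), with <rho^*(x) u, v> = - <u, rho(x) v>. *)
Definition dual_rep W V (rho : 'Hom(W, 'End(V))) : 'Hom(W, 'End(dual V)) :=
  bilin (fun (x : W) (u : dual V) => - (u \o rho x)%VF).

Lemma dual_repE W V (rho : 'Hom(W, 'End(V))) x (u : dual V) v :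
  dual_rep rho x u v = - u (rho x v).
Proof.
rewrite /dual_rep bilinE; first by rewrite opp_lfunE comp_lfunE.
- move=> w k y z; rewrite linearP /= comp_lfunDr opprD.
  by rewrite -comp_lfunZr scalerN.
- by move=> w k y z; rewrite comp_lfunDl opprD -comp_lfunZl scalerN.
Qed.

Definition bidual V : 'Hom(V, dual (dual V)) :=
  bilin (fun (x : V) (u : dual V) => u x : K^o).

Lemma bidualE V (x : V) (u : dual V) : bidual V x u = u x.
Proof.
rewrite /bidual bilinE // => z k v w; first exact: linearP.
by rewrite add_lfunE scale_lfunE.
Qed.

Lemma dual_sep V (x : V) : (forall u : dual V, u x = 0) -> x = 0.
Proof.
move=> ux0; rewrite (coord_vbasis (memvf x)) big1 // => i _.
pose c := coord (vbasis {:V}) i.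
have cl : linear (c : V -> K^o) by move=> k u v; rewrite /c linearP.
pose cS := GRing.isLinear.Build K V K^o *:%R c cl.
pose cc : {linear V -> K^o} := HB.pack (c : V -> K^o) cS.
by have := ux0 (linfun cc); rewrite lfunE /= -/c => ->; rewrite scale0r.
Qed.

Lemma bidual_lker0 V : lker (bidual V) == 0%VS.
Proof.
apply/lker0P => x y exy; apply/eqP; rewrite -subr_eq0; apply/eqP/dual_sep => u.
by rewrite linearB /= -(bidualE x) -(bidualE y) exy subrr.
Qed.

Lemma bidual_limg V : limg (bidual V) = fullv.
Proof.
apply/eqP; rewrite eqEdim subvf limg_dim_eq; last first.
  by rewrite (eqP (bidual_lker0 V)) capv0.
have dd (U : vectType K) : dim (dual U) = dim U by rewrite -[RHS]muln1.
by rewrite !dimvf !dd leqnn.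
Qed.

Lemma bidualVK V : cancel (bidual V)^-1%VF (bidual V).
Proof. by move=> f; rewrite limg_lfunVK // bidual_limg memvf. Qed.

(* The dual of a representation on V^* , which acts on V^** , transported to V
   along the canonical isomorphism V -> V^**. *)
Definition dual_rep_on_dual W V (rho : 'Hom(W, 'End(dual V))) :
    'Hom(W, 'End(V)) :=
  bilin (fun (a : W) (x : V) =>
    (bidual V)^-1%VF (dual_rep rho a (bidual V x))).

Lemma dual_rep_on_dualE W V (rho : 'Hom(W, 'End(dual V))) a x (u : dual V) :
  u (dual_rep_on_dual rho a x) = - (rho a u) x.
Proof.
rewrite /dual_rep_on_dual bilinE.
- by rewrite -bidualE bidualVK dual_repE bidualE.
- by move=> v k b c; rewrite linearP /= add_lfunE scale_lfunE linearP.
- by move=> v k b c; rewrite !linearP.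
Qed.

Definition lie_rep W V (br : bilop W) (rho : 'Hom(W, 'End(V))) : Prop :=
  forall x y, rho (br x y) = (rho x \o rho y)%VF - (rho y \o rho x)%VF.

Definition anti_pre_lie_rep W V (mu : bilop W) (l r : 'Hom(W, 'End(V))) :
    Prop :=
  [/\ forall x y, l (mu y x) - l (mu x y) = (l x \o l y)%VF - (l y \o l x)%VF,
      forall x y,
        r (mu x y) = (l x \o r y)%VF + (r y \o l x)%VF - (r y \o r x)%VF &
      forall x y, l (mu y x) - l (mu x y)
        = (r x \o l y)%VF - (r y \o l x)%VF - (r x \o r y)%VF + (r y \o r x)%VF].

End Representations.

Section MatchedPairs.
Variable K : fieldType.

Record lie_matched_pair (g h : vectType K) (brg : bilop g) (brh : bilop h)
    (rhog : 'Hom(g, 'End(h))) (rhoh : 'Hom(h, 'End(g))) : Prop := {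
  lmp_lieg : lie_bracket brg;
  lmp_lieh : lie_bracket brh;
  lmp_repg : lie_rep brg rhog;
  lmp_reph : lie_rep brh rhoh;
  lmp_compatg : forall (x : g) (a b : h),
    rhog x (brh a b) - brh (rhog x a) b - brh a (rhog x b)
      + rhog (rhoh a x) b - rhog (rhoh b x) a = 0;
  lmp_compath : forall (a : h) (x y : g),
    rhoh a (brg x y) - brg (rhoh a x) y - brg x (rhoh a y)
      + rhoh (rhog x a) y - rhoh (rhog y a) x = 0
}.

Definition apl_compat (A B : vectType K) (mu : bilop A)
    (lA rA : 'Hom(A, 'End(B))) (lB rB : 'Hom(B, 'End(A))) : Prop :=
  [/\ forall (x y : A) (a : B),
        rB (lA y a) x + mu x (rB a y) - rB (lA x a) y - mu y (rB a x)
        = rB a (commutator mu y x),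
      forall (x y : A) (a : B),
        mu x (lB a y) + rB (rA y a) x - lB a (mu x y)
        = mu ((lB - rB) a x) y + lB ((rA - lA) x a) y &
      forall (x y : A) (a : B),
        rB a (commutator mu x y)
        = mu ((lB - rB) a y) x + mu ((rB - lB) a x) y
          + lB ((rA - lA) y a) x + lB ((lA - rA) x a) y].

Record apl_matched_pair (A B : vectType K) (muA : bilop A) (muB : bilop B)
    (lA rA : 'Hom(A, 'End(B))) (lB rB : 'Hom(B, 'End(A))) : Prop := {
  amp_aplA : anti_pre_lie muA;
  amp_aplB : anti_pre_lie muB;
  amp_repA : anti_pre_lie_rep muA lA rA;
  amp_repB : anti_pre_lie_rep muB lB rB;
  amp_compatA : apl_compat muA lA rA lB rB;
  amp_compatB : apl_compat muB lB rB lA rA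
}.

End MatchedPairs.

Section ManinTriples.
Variables (K : fieldType) (V : vectType K).

Definition inl_dual (x : V) : V * dual V := (x, 0).
Definition inr_dual (a : dual V) : V * dual V := (0, a).

Definition Bd (u v : V * dual V) : K := v.2 u.1 + u.2 v.1.

Definition contains_summands (mu : bilop V) (nu : bilop (dual V))
    (op : bilop (V * dual V)%type) : Prop :=
  {morph inl_dual : x y / mu x y >-> op x y} /\
  {morph inr_dual : a b / nu a b >-> op a b}.

Record manin_triple (br : bilop V) (brd : bilop (dual V))
    (brD : bilop (V * dual V)%type) : Prop := {
  mt_lie : lie_bracket br;
  mt_lied : lie_bracket brd;
  mt_lieD : lie_bracket brD;
  mt_sub : contains_summands br brd brD;
  mt_cocycle : commutative_2cocycle brD Bd
}.

(* brD makes g(A) + g(A^* ) a Manin triple whose induced anti-pre-Lie algebra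
   contains (V, mu) and (V^* , nu) as subalgebras. Bd is nondegenerate, so op
   is the anti-pre-Lie operation attached to brD. *)
Definition anti_pre_lie_manin_triple (mu : bilop V) (nu : bilop (dual V))
    (brD : bilop (V * dual V)%type) : Prop :=
  manin_triple (commutator mu) (commutator nu) brD /\
  exists op : bilop (V * dual V)%type,
    compatible_anti_pre_lie brD Bd op /\ contains_summands mu nu op.

End ManinTriples.

(* Main.v *)
From HB Require Import structures.
Require Import Defs.
From mathcomp Require Import all_boot all_algebra.
From mathcomp Require Import ring.

(* On the direct sum of A and its dual consider the operation op assembled from
   the two anti-pre-Lie structures and the four given maps, and its commutator.
   For arbitrary spaces, a matched pair of anti-pre-Lie (resp. Lie) algebras is
   the same as an anti-pre-Lie (resp. Lie) structure on the sum of this shape,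
   and the commutator of op is built from the differences l - r, which here are
   -L^*; this gives (2) => (3).  Invariance of the form forces the operation in
   (1) to be op, which gives (1) => (2).  Conversely B_d is always a cocycle for
   the commutator of op, and in characteristic other than 2 an operation that is
   invariant for a nondegenerate cocycle is anti-pre-Lie as soon as the bracket
   is Lie; this gives (3) => (1).  For a given Manin triple, the operations on the
   two summands are read off from the mixed brackets through the duality. *)

Set Implicit Arguments.
Unset Strict Implicit.
Unset Printing Implicit Defensive.

Import GRing.Theory.
Local Open Scope ring_scope.

(* The canonical structures on [dual V] and on products come wrapped in
   [reverse_coercion] or not, depending on how they were inferred; unfolding it
   first makes the comparison of the two forms about ten times faster. *)
Strategy expand [reverse_coercion].

(** * Tools for multilinear identities *)

Lemma dual_eq (K : fieldType) (V : vectType K) (x y : V) :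
  (forall u : dual V, u x = u y) -> x = y.
Proof.
move=> exy; apply/eqP; rewrite -subr_eq0; apply/eqP/dual_sep => u.
by rewrite linearB /= exy subrr.
Qed.

Lemma lfunD (K : fieldType) (U V : vectType K) (f : 'Hom(U, V)) x y :
  f (x + y) = f x + f y.
Proof. exact: linearD. Qed.

Lemma lfunN (K : fieldType) (U V : vectType K) (f : 'Hom(U, V)) x :
  f (- x) = - f x.
Proof. exact: linearN. Qed.

(** Derives a goal from a combination [a = b] of known equations: what remains is a formal identity,
    left to [ring] or [bil_ring]. *)
Lemma subr_eq_trans (V : zmodType) (a b c d : V) :
  a = b -> c - d = a - b -> c = d.
Proof. by move=> ->; rewrite subrr => /subr0_eq. Qed.

Lemma add_eq (V : zmodType) (a b c d : V) : a = b -> c = d -> a + c = b + d.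
Proof. by move=> -> ->. Qed.

Lemma sub_eq (V : zmodType) (a b c d : V) : a = b -> c = d -> a - c = b - d.
Proof. by move=> -> ->. Qed.

Lemma lfun_eq (K : fieldType) (U V : vectType K) (f g : 'Hom(U, V)) x :
  f = g -> f x = g x.
Proof. by move=> ->. Qed.

(* Rewriting with additivity directly on [f x y] is slow, as each failed match
   unfolds the two coercions; a locked copy avoids this. *)
HB.lock Definition bil_app (K : fieldType) (U V W : vectType K)
  (f : 'Hom(U, 'Hom(V, W))) x y := f x y.

Section BilApp.
Variables (K : fieldType) (U V W : vectType K).
Implicit Types f g : 'Hom(U, 'Hom(V, W)).

Lemma bil_appE f x y : f x y = bil_app f x y.
Proof. by rewrite !bil_app.unlock. Qed.

Lemma bil_app0l f y : bil_app f 0 y = 0.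
Proof. by rewrite !bil_app.unlock linear0 zero_lfunE. Qed.
Lemma bil_app0r f x : bil_app f x 0 = 0.
Proof. by rewrite !bil_app.unlock linear0. Qed.
Lemma bil_appDl f x y z : bil_app f (x + y) z = bil_app f x z + bil_app f y z.
Proof. by rewrite !bil_app.unlock linearD add_lfunE. Qed.
Lemma bil_appDr f x y z : bil_app f x (y + z) = bil_app f x y + bil_app f x z.
Proof. by rewrite !bil_app.unlock linearD. Qed.
Lemma bil_appNl f x y : bil_app f (- x) y = - bil_app f x y.
Proof. by rewrite !bil_app.unlock linearN opp_lfunE. Qed.
Lemma bil_appNr f x y : bil_app f x (- y) = - bil_app f x y.
Proof. by rewrite !bil_app.unlock linearN. Qed.
Lemma add_bil_app f g x y : bil_app (f + g) x y = bil_app f x y + bil_app g x y.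
Proof. by rewrite !bil_app.unlock !add_lfunE. Qed.
Lemma opp_bil_app f x y : bil_app (- f) x y = - bil_app f x y.
Proof. by rewrite !bil_app.unlock !opp_lfunE. Qed.

End BilApp.

Definition bil_app_simp := (bil_appDl, bil_appDr, bil_appNl, bil_appNr,
  bil_app0l, bil_app0r, add_bil_app, opp_bil_app).

(** * Operations on a direct sum *)

Section MatchedOp.
Variables (K : fieldType) (A B : vectType K).

Definition matched_op (muA : bilop A) (muB : bilop B)
    (lA rA : 'Hom(A, 'End(B))) (lB rB : 'Hom(B, 'End(A))) :
    bilop (A * B)%type :=
  bilin (fun u v : A * B =>
    (muA u.1 v.1 + lB u.2 v.1 + rB v.2 u.1,
     muB u.2 v.2 + lA u.1 v.2 + rA v.1 u.2)).

Lemma matched_opE muA muB lA rA lB rB u v :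
  matched_op muA muB lA rA lB rB u v =
  (muA u.1 v.1 + lB u.2 v.1 + rB v.2 u.1,
   muB u.2 v.2 + lA u.1 v.2 + rA v.1 u.2).
Proof.
rewrite /matched_op bilinE // => w k s t; congr pair;
  rewrite !linearP /= ?add_lfunE ?scale_lfunE ?linearP /= !scalerDr;
  by rewrite [RHS]addrACA; congr (_ + _); rewrite [RHS]addrACA.
Qed.

End MatchedOp.

(* [ring] proves the identity after applying a linear functional [f], whose
   additivity it uses. *)
Ltac bil_ring :=
  rewrite /= ?commutatorE ?bil_appE ?(comp_lfunE, add_lfunE, opp_lfunE);
  rewrite ?bil_appE ?bil_app_simp;
  let f := fresh "f" in
  apply: dual_eq => f; ring.

(** By the cyclic sum of the first axiom, the Jacobi sum is -2 times the cyclic sum that the second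
    axiom kills. *)
Lemma anti_pre_lie_lie_bracket (K : fieldType) (V : vectType K) (mu : bilop V) :
  anti_pre_lie mu -> lie_bracket (commutator mu).
Proof.
move=> [mu1 mu2]; split=> [x|x y z]; first by rewrite commutatorE subrr.
apply: (subr_eq_trans (sub_eq
  (add_eq (mu1 x y z) (add_eq (mu1 y z x) (mu1 z x y)))
  (add_eq (mu2 x y z) (mu2 x y z)))).
by bil_ring.
Qed.

Lemma lie_bracket_skew (K : fieldType) (V : vectType K) (br : bilop V) x y :
  lie_bracket br -> br x y + br y x = 0.
Proof.
case=> br0 _; have := br0 (x + y).
by rewrite bil_appE bil_appDl !bil_appDr -!bil_appE !br0 add0r addr0.
Qed.

Section MatchedOpSummands.
Variables (K : fieldType) (A B : vectType K) (muA : bilop A) (muB : bilop B).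
Variables (lA rA : 'Hom(A, 'End(B))) (lB rB : 'Hom(B, 'End(A))).

Lemma matched_op_inl x y :
  (muA x y, 0) = matched_op muA muB lA rA lB rB (x, 0) (y, 0).
Proof. by rewrite matched_opE; apply: injective_projections; bil_ring. Qed.

Lemma matched_op_inr a b :
  (0, muB a b) = matched_op muA muB lA rA lB rB (0, a) (0, b).
Proof. by rewrite matched_opE; apply: injective_projections; bil_ring. Qed.

End MatchedOpSummands.

Ltac matched_component H :=
  apply: (subr_eq_trans H); rewrite !(commutatorE, matched_opE); bil_ring.

(** * Matched pairs as structures on the direct sum *)

Section MatchedPairs.
Variables (K : fieldType) (A B : vectType K).
Variables (muA : bilop A) (muB : bilop B).

Section AntiPreLie.
Variables (lA rA : 'Hom(A, 'End(B))) (lB rB : 'Hom(B, 'End(A))).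
Let op := matched_op muA muB lA rA lB rB.

Lemma matched_op_anti_pre_lie :
  apl_matched_pair muA muB lA rA lB rB -> anti_pre_lie op.
Proof.
case=> [[A1 A2] [B1 B2] [rA1 rA2 rA3] [rB1 rB2 rB3] [cA1 cA2 cA3] [cB1 cB2 cB3]].
(* By trilinearity, each component of either identity is a signed sum of axioms,
   one for each way of choosing the summands of the three arguments. *)
split=> [[x a] [y b] [z c]|[x a] [y b] [z c]];
  rewrite /op !(commutatorE, matched_opE) /=; apply: injective_projections => /=.
- apply: (subr_eq_trans (sub_eq
    (add_eq (A1 x y z) (add_eq (cA1 x y c) (add_eq (cA2 x z b)
      (lfun_eq x (rB2 b c)))))
    (add_eq (cA2 y z a) (add_eq (lfun_eq z (rB1 a b)) (lfun_eq y (rB2 a c)))))).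
  by bil_ring.
- apply: (subr_eq_trans (sub_eq
    (add_eq (B1 a b c) (add_eq (cB1 a b z) (add_eq (cB2 a c y)
      (lfun_eq a (rA2 y z)))))
    (add_eq (cB2 b c x) (add_eq (lfun_eq c (rA1 x y)) (lfun_eq b (rA2 x z)))))).
  by bil_ring.
- apply: (subr_eq_trans (sub_eq
    (add_eq (A2 x y z) (add_eq (cA3 x y c) (add_eq (cA3 y z a) (cA3 z x b))))
    (add_eq (lfun_eq x (rB3 b c))
      (add_eq (lfun_eq y (rB3 c a)) (lfun_eq z (rB3 a b)))))).
  by bil_ring.
- apply: (subr_eq_trans (sub_eq
    (add_eq (B2 a b c) (add_eq (cB3 a b z) (add_eq (cB3 b c x) (cB3 c a y))))
    (add_eq (lfun_eq a (rA3 y z))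
      (add_eq (lfun_eq b (rA3 z x)) (lfun_eq c (rA3 x y)))))).
  by bil_ring.
Qed.

(** Each axiom of a matched pair is one component of one anti-pre-Lie identity, taken at arguments
    that each lie in a single summand. *)
Lemma anti_pre_lie_matched_op :
  anti_pre_lie op -> apl_matched_pair muA muB lA rA lB rB.
Proof.
rewrite /op => -[H1 H2].
pose iA (x : A) : A * B := (x, 0); pose iB (a : B) : A * B := (0, a).
pose A1 u v w := congr1 fst (H1 u v w); pose B1 u v w := congr1 snd (H1 u v w).
pose A2 u v w := congr1 fst (H2 u v w); pose B2 u v w := congr1 snd (H2 u v w).
split; split; try (move=> x y; apply/lfunP => z); try move=> x y z.
- by matched_component (A1 (iA x) (iA y) (iA z)).
- by matched_component (A2 (iA x) (iA y) (iA z)).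
- by matched_component (B1 (iB x) (iB y) (iB z)).
- by matched_component (B2 (iB x) (iB y) (iB z)).
- by matched_component (esym (B1 (iA x) (iA y) (iB z))).
- by matched_component (B1 (iB z) (iA x) (iA y)).
- by matched_component (esym (B2 (iB z) (iA x) (iA y))).
- by matched_component (esym (A1 (iB x) (iB y) (iA z))).
- by matched_component (A1 (iA z) (iB x) (iB y)).
- by matched_component (esym (A2 (iA z) (iB x) (iB y))).
- by matched_component (A1 (iA x) (iA y) (iB z)).
- by matched_component (A1 (iA x) (iB z) (iA y)).
- by matched_component (A2 (iA x) (iA y) (iB z)).
- by matched_component (B1 (iB x) (iB y) (iA z)).
- by matched_component (B1 (iB x) (iA z) (iB y)).
- by matched_component (B2 (iB x) (iB y) (iA z)).
Qed.

(** The right actions become the opposites of the left ones, which is the shape that encodes a Lie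
    matched pair with actions [lA - rA] and [lB - rB]. *)
Lemma commutator_matched_op :
  commutator op = matched_op (commutator muA) (commutator muB)
    (lA - rA) (- (lA - rA)) (lB - rB) (- (lB - rB)).
Proof.
apply/lfunP => u; apply/lfunP => v.
by rewrite commutatorE !matched_opE; apply: injective_projections; bil_ring.
Qed.

End AntiPreLie.

Section Lie.
Variables (rhoA : 'Hom(A, 'End(B))) (rhoB : 'Hom(B, 'End(A))).
Let br := matched_op muA muB rhoA (- rhoA) rhoB (- rhoB).

Lemma matched_op_lie_bracket :
  lie_matched_pair muA muB rhoA rhoB -> lie_bracket br.
Proof.
case=> lieA lieB repA repB cA cB.
have [A0 AJ] := lieA; have [B0 BJ] := lieB.
pose sA x y := lie_bracket_skew x y lieA.
pose sB x y := lie_bracket_skew x y lieB.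
split=> [[x a]|[x a] [y b] [z c]];
  rewrite /br !matched_opE /=; apply: injective_projections => /=.
- by apply: (subr_eq_trans (A0 x)); bil_ring.
- by apply: (subr_eq_trans (B0 a)); bil_ring.
(* The Jacobi sum has [rhoB c x] only as a right factor of [muA], while [cB c x y] has it on the
   left; the instances of [sA] exchange the two. *)
- apply: (subr_eq_trans (sub_eq
    (add_eq (AJ x y z) (add_eq (cB c x y) (add_eq (cB a y z) (add_eq (cB b z x)
      (add_eq (sA y (rhoB c x)) (add_eq (sA z (rhoB a y)) (sA x (rhoB b z))))))))
    (add_eq (lfun_eq x (repB b c))
      (add_eq (lfun_eq y (repB c a)) (lfun_eq z (repB a b)))))).
  by bil_ring.
- apply: (subr_eq_trans (sub_eq
    (add_eq (BJ a b c) (add_eq (cA z a b) (add_eq (cA x b c) (add_eq (cA y c a)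
      (add_eq (sB b (rhoA z a)) (add_eq (sB c (rhoA x b)) (sB a (rhoA y c))))))))
    (add_eq (lfun_eq a (repA y z))
      (add_eq (lfun_eq b (repA z x)) (lfun_eq c (repA x y)))))).
  by bil_ring.
Qed.

(** The Jacobi identity at two arguments from one summand and one from the other has a
    representation law in one component and a compatibility condition in the other. *)
Lemma lie_bracket_matched_op :
  lie_bracket br -> lie_matched_pair muA muB rhoA rhoB.
Proof.
move=> lie_br; have [] := lie_br; rewrite /br => br0 J.
pose iA (x : A) : A * B := (x, 0); pose iB (a : B) : A * B := (0, a).
pose JA u v w := congr1 fst (J u v w); pose JB u v w := congr1 snd (J u v w).
have lieA : lie_bracket muA.
  split=> [x|x y z]; first by matched_component (congr1 fst (br0 (iA x))).
  by matched_component (JA (iA x) (iA y) (iA z)).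
have lieB : lie_bracket muB.
  split=> [a|a b c]; first by matched_component (congr1 snd (br0 (iB a))).
  by matched_component (JB (iB a) (iB b) (iB c)).
split=> // [x y|a b|x a b|a x y]; try (apply/lfunP => z).
- by matched_component (esym (JB (iB z) (iA x) (iA y))).
- by matched_component (esym (JA (iA z) (iB a) (iB b))).
- by matched_component
    (sub_eq (JB (iB a) (iB b) (iA x)) (lie_bracket_skew b (rhoA x a) lieB)).
- by matched_component
    (sub_eq (JA (iA x) (iA y) (iB a)) (lie_bracket_skew y (rhoB a x) lieA)).
Qed.

End Lie.

End MatchedPairs.

Lemma apl_lie_matched_pair (K : fieldType) (A B : vectType K)
    (muA : bilop A) (muB : bilop B)
    (lA rA : 'Hom(A, 'End(B))) (lB rB : 'Hom(B, 'End(A))) :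
  apl_matched_pair muA muB lA rA lB rB ->
  lie_matched_pair (commutator muA) (commutator muB) (lA - rA) (lB - rB).
Proof.
move=> /matched_op_anti_pre_lie/anti_pre_lie_lie_bracket.
by rewrite commutator_matched_op; apply: lie_bracket_matched_op.
Qed.

(** * Invariant operations for a nondegenerate cocycle *)

Section Cocycle.
Variables (K : fieldType) (V : vectType K) (br mu : bilop V) (B : V -> V -> K).

(** Identities are tested against [B], where invariance trades [mu] for the bracket. The cocycle
    condition then gives [commutator mu = br], and the first axiom becomes the Jacobi identity. *)
Lemma cocycle_compatible :
  (2 : K) != 0 -> lie_bracket br -> commutative_2cocycle br B ->
  (forall u, (forall w, B u w = 0) -> u = 0) ->
  (forall u v w, B (mu u v) w = B v (br u w)) ->
  compatible_anti_pre_lie br B mu.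
Proof.
move=> two0 lie [[Bl Br] Bsym Bcyc] Bnd muB.
have [_ jac] := lie.
have BD u v w : B (u + v) w = B u w + B v w.
  by have := Bl w 1 u v; rewrite scale1r /= mul1r.
have BN u w : B (- u) w = - B u w.
  have B0 : B 0 w = 0 by apply: (addrI (B 0 w)); rewrite -BD !addr0.
  by apply/eqP; rewrite -addr_eq0 -BD addNr B0.
have eqB u v : (forall w, B u w = B v w) -> u = v.
  move=> uv; apply/eqP; rewrite -subr_eq0; apply/eqP/Bnd => w.
  by rewrite BD BN uv subrr.
have brN x y : br x y = - br y x.
  by apply/eqP; rewrite -addr_eq0 lie_bracket_skew.
have jacB x y z w : B (br x (br y z)) w + B (br y (br z x)) w
    + B (br z (br x y)) w = 0.
  by rewrite -!BD jac -[X in B X w](subrr 0) BD BN subrr.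
have brNr x y : br x (- y) = - br x y by rewrite linearN.
have comm_mu : commutator mu = br.
  apply/lfunP => x; apply/lfunP => y; apply: eqB => w.
  rewrite commutatorE BD BN !muB.
  have := Bcyc x w y; rewrite (brN w y) (brN y x) !BN (Bsym (br x w)).
  rewrite (Bsym _ x) (Bsym _ w) => /eqP; rewrite subr_eq0 => /eqP ->.
  by rewrite Bsym.
have mu1 x y z : mu x (mu y z) - mu y (mu x z) = mu (commutator mu y x) z.
  apply: eqB => w; rewrite comm_mu BD BN !muB !(Bsym z).
  apply: (subr_eq_trans (jacB x w y z)).
  by rewrite (brN (br y x)) (brN w y) (brN y x) !brNr !(BN, opprK); ring.
split=> //; split=> // x y z.
(* The Jacobi identity and [mu1] force twice the cyclic sum to vanish. *)
rewrite comm_mu; set S := (X in X = 0).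
suff SS : S + S = 0.
  by apply/eqP; move/eqP: SS; rewrite -mulr2n -scaler_nat scaler_eq0 (negPf two0).
apply: (subr_eq_trans (sub_eq
  (add_eq (mu1 x y z) (add_eq (mu1 y z x) (mu1 z x y))) (jac x y z))).
by rewrite /S -comm_mu; bil_ring.
Qed.

End Cocycle.

(** * Dual actions and their sums *)

Section DualRep.
Variables (K : fieldType) (W V : vectType K).

Lemma opp_dual_repE (rho : 'Hom(W, 'End(V))) x (u : dual V) v :
  (- dual_rep rho) x u v = u (rho x v).
Proof. by rewrite !opp_lfunE dual_repE opprK. Qed.

Lemma opp_dual_rep_on_dualE (rho : 'Hom(W, 'End(dual V))) a v (u : dual V) :
  u ((- dual_rep_on_dual rho) a v) = rho a u v.
Proof. by rewrite !opp_lfunE lfunN dual_rep_on_dualE opprK. Qed.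

Lemma dual_repD (rho sigma : 'Hom(W, 'End(V))) :
  dual_rep (rho + sigma) = dual_rep rho + dual_rep sigma.
Proof.
apply/lfunP => x; apply/lfunP => u; apply/lfunP => v.
by rewrite !add_lfunE !dual_repE !add_lfunE lfunD opprD.
Qed.

Lemma dual_rep_on_dualD (rho sigma : 'Hom(W, 'End(dual V))) :
  dual_rep_on_dual (rho + sigma) = dual_rep_on_dual rho + dual_rep_on_dual sigma.
Proof.
apply/lfunP => a; apply/lfunP => v; apply: dual_eq => u.
by rewrite 2!add_lfunE lfunD !dual_rep_on_dualE !add_lfunE opprD.
Qed.

Lemma subr_opp_dual_rep (rho sigma tau : 'Hom(W, 'End(V))) :
  rho + sigma = tau -> - dual_rep rho - dual_rep sigma = - dual_rep tau.
Proof. by move=> <-; rewrite dual_repD opprD. Qed.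

Lemma subr_opp_dual_rep_on_dual (rho sigma tau : 'Hom(W, 'End(dual V))) :
  rho + sigma = tau ->
  - dual_rep_on_dual rho - dual_rep_on_dual sigma = - dual_rep_on_dual tau.
Proof. by move=> <-; rewrite dual_rep_on_dualD opprD. Qed.

End DualRep.

(** * Direct sums of two spaces in duality *)

(* The space [B] stands for [dual A], which enters only at the very end:
   comparing the canonical structures on [dual A] is expensive. *)
Section Pairing.
Variables (K : fieldType) (A B : vectType K) (pair : B -> A -> K).
Hypothesis pair_bilinear : bilinear_for *%R *%R pair.
Hypothesis pair_sepl : forall b, (forall x, pair b x = 0) -> b = 0.
Hypothesis pair_sepr : forall x, (forall b, pair b x = 0) -> x = 0.

(** For the evaluation pairing of [dual A] with [A] this is [Bd]. *)
Definition pairing_form (u v : A * B) : K := pair v.2 u.1 + pair u.2 v.1.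

Let pairDl a b x : pair (a + b) x = pair a x + pair b x.
Proof. by have := pair_bilinear.1 x 1 a b; rewrite scale1r /= mul1r. Qed.
Let pairDr b x y : pair b (x + y) = pair b x + pair b y.
Proof. by have := pair_bilinear.2 b 1 x y; rewrite scale1r /= mul1r. Qed.
Let pair0l x : pair 0 x = 0.
Proof. by apply: (addrI (pair 0 x)); rewrite -pairDl !addr0. Qed.
Let pair0r b : pair b 0 = 0.
Proof. by apply: (addrI (pair b 0)); rewrite -pairDr !addr0. Qed.
Let pairNl b x : pair (- b) x = - pair b x.
Proof. by apply/eqP; rewrite -addr_eq0 -pairDl addNr pair0l. Qed.
Let pairNr b x : pair b (- x) = - pair b x.
Proof. by apply/eqP; rewrite -addr_eq0 -pairDr addNr pair0r. Qed.

Lemma pairing_form_bilinear : bilinear_for *%R *%R pairing_form.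
Proof.
by split=> w k u v; rewrite /pairing_form /=;
  rewrite (pair_bilinear.2 _ k) (pair_bilinear.1 _ k) /=; ring.
Qed.

Lemma pairing_form_sym u v : pairing_form u v = pairing_form v u.
Proof. by rewrite /pairing_form addrC. Qed.

Lemma pairing_formBl u v w :
  pairing_form (u - v) w = pairing_form u w - pairing_form v w.
Proof. by rewrite /pairing_form /= pairDl pairDr pairNl pairNr; ring. Qed.

Lemma pairing_formDl u v w :
  pairing_form (u + v) w = pairing_form u w + pairing_form v w.
Proof. by rewrite /pairing_form /= pairDl pairDr; ring. Qed.

Lemma pairing_form_nondegenerate u : (forall w, pairing_form u w = 0) -> u = 0.
Proof.
move=> u0; apply: injective_projections => /=.
  apply: pair_sepr => b; have := u0 (0, b).
  by rewrite /pairing_form /= pair0r addr0.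
apply: pair_sepl => x; have := u0 (x, 0).
by rewrite /pairing_form /= pair0l add0r.
Qed.

Lemma pairing_form_eq u v :
  (forall w, pairing_form u w = pairing_form v w) -> u = v.
Proof.
move=> uv; apply/subr0_eq/pairing_form_nondegenerate => w.
by rewrite pairing_formBl uv subrr.
Qed.

(** The counterpart of [contains_summands] over the abstract space [B]. *)
Definition double_summands (mu : bilop (A * B)%type) (muA : bilop A)
    (muB : bilop B) : Prop :=
  (forall x y, (muA x y, 0) = mu (x, 0) (y, 0)) /\
  (forall a b, (0, muB a b) = mu (0, a) (0, b)).

(** * The double of two operations *)

Section Double.
Variables (opA : bilop A) (opB : bilop B).
Variables (lA rA : 'Hom(A, 'End(B))) (lB rB : 'Hom(B, 'End(A))).
Hypothesis lAE : forall x b y, pair (lA x b) y = pair b (commutator opA x y).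
Hypothesis rAE : forall x b y, pair (rA x b) y = - pair b (opA y x).
Hypothesis lBE : forall a x c, pair c (lB a x) = pair (commutator opB a c) x.
Hypothesis rBE : forall a x c, pair c (rB a x) = - pair (opB c a) x.
Let op := matched_op opA opB lA rA lB rB.

(** Moving the four actions across the pairing leaves only values of [opA] and [opB], so that
    invariance and the cocycle condition become identities for [ring] in [K]. *)
Lemma pairing_form_matched_opE x y z a b c :
  pairing_form (op (x, a) (y, b)) (z, c) =
  pair c (opA x y) + pair (opB a c) y - pair (opB c a) y - pair (opB c b) x
  + pair (opB a b) z + pair b (opA x z) - pair b (opA z x) - pair a (opA z y).
Proof.
rewrite /pairing_form matched_opE /= !(pairDl, pairDr) lAE rAE lBE rBE.
by rewrite !commutatorE !(pairDl, pairDr, pairNl, pairNr); ring.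
Qed.

Lemma pairing_form_commutatorE x y z a b c :
  pairing_form (commutator op (x, a) (y, b)) (z, c) =
  pair c (opA x y) - pair c (opA y x) + pair (opB a c) y - pair (opB b c) x
  + pair (opB a b) z - pair (opB b a) z + pair b (opA x z) - pair a (opA y z).
Proof.
by rewrite commutatorE pairing_formBl !pairing_form_matched_opE; ring.
Qed.

Lemma pairing_form_matched_op u v w :
  pairing_form (op u v) w = pairing_form v (commutator op u w).
Proof.
case: u v w => [x a] [y b] [z c]; rewrite [RHS]pairing_form_sym.
by rewrite pairing_form_matched_opE pairing_form_commutatorE; ring.
Qed.

Lemma pairing_form_cocycle :
  commutative_2cocycle (commutator op) pairing_form.
Proof.
split; [exact: pairing_form_bilinear | exact: pairing_form_sym |].
by move=> [x a] [y b] [z c]; rewrite !pairing_form_commutatorE; ring.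
Qed.

Lemma double_compatible :
  (2 : K) != 0 -> lie_bracket (commutator op) ->
  compatible_anti_pre_lie (commutator op) pairing_form op.
Proof.
move=> two0 lie; apply: cocycle_compatible => //.
- exact: pairing_form_cocycle.
- exact: pairing_form_nondegenerate.
- exact: pairing_form_matched_op.
Qed.

(** A bracket is fixed by its restrictions to the summands and the mixed brackets; the last two
    premises give one component of the latter each, up to skew-symmetry. *)
Lemma double_bracket_unique br :
  lie_bracket br ->
  double_summands br (commutator opA) (commutator opB) ->
  (forall x c y, pair (br (x, 0) (0, c)).2 y = pair c (opA x y)) ->
  (forall a x b, pair b (br (0, a) (x, 0)).1 = pair (opB a b) x) ->
  br = commutator op.
Proof.
move=> lie [brA brB] EA EB.
have skew x b : br (x, 0) (0, b) = - br (0, b) (x, 0).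
  by apply/eqP; rewrite -addr_eq0 lie_bracket_skew.
have cross x b z c : pairing_form (br (x, 0) (0, b)) (z, c)
    = pair b (opA x z) - pair (opB b c) x.
  by rewrite /pairing_form /= EA skew /= pairNr EB addrC.
apply/lfunP => -[x a]; apply/lfunP => -[y b]; apply: pairing_form_eq => -[z c].
have dec t e : (t, e) = (t, 0) + (0, e) :> A * B.
  by apply: injective_projections; rewrite /= ?addr0 ?add0r.
rewrite pairing_form_commutatorE (dec x) (dec y).
rewrite bil_appE bil_appDl !bil_appDr -!bil_appE -brA -brB !pairing_formDl.
(* The bracket of [a] with [y] is written as [0 - [y, a]], to which [cross] applies. *)
rewrite cross -[br (0, a) (y, 0)]opprK -skew -[- br _ _]sub0r pairing_formBl cross.
by rewrite /pairing_form /= !commutatorE pair0l pair0r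
  !(pairDl, pairDr, pairNl, pairNr); ring.
Qed.

(** Invariance at two arguments from one summand and one from the other computes the mixed brackets
    from [opA] and [opB], which forces [br]; nondegeneracy then forces [op0]. *)
Lemma double_op_unique br op0 :
  compatible_anti_pre_lie br pairing_form op0 -> lie_bracket br ->
  double_summands br (commutator opA) (commutator opB) ->
  double_summands op0 opA opB ->
  op0 = op.
Proof.
case=> _ _ op0E lie br_sub [opAE opBE].
have def_br : br = commutator op.
  apply: double_bracket_unique => // [x c y|a x b].
    have := op0E (x, 0) (y, 0) (0, c).
    by rewrite -opAE /pairing_form /= !pair0l !addr0.
  have := op0E (0, a) (0, b) (x, 0).
  by rewrite -opBE /pairing_form /= !pair0r !add0r.
apply/lfunP => u; apply/lfunP => v; apply: pairing_form_eq => w.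
by rewrite op0E def_br pairing_form_matched_op.
Qed.

Lemma double_apl_matched_pair br op0 :
  compatible_anti_pre_lie br pairing_form op0 -> lie_bracket br ->
  double_summands br (commutator opA) (commutator opB) ->
  double_summands op0 opA opB ->
  apl_matched_pair opA opB lA rA lB rB.
Proof.
move=> compat lie br_sub op0_sub; have [aplop _ _] := compat.
apply: anti_pre_lie_matched_op.
by rewrite -/op -(double_op_unique compat lie br_sub op0_sub).
Qed.

(** That [opA] and [opB] are anti-pre-Lie is part of the conclusion, for use when they are extracted
    from a given bracket. *)
Lemma double_manin_triple : (2 : K) != 0 -> lie_bracket (commutator op) ->
  exists op0, [/\ anti_pre_lie opA, anti_pre_lie opB,
    compatible_anti_pre_lie (commutator op) pairing_form op0 &
    double_summands op0 opA opB].
Proof.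
move=> two0 lie; have compat := double_compatible two0 lie.
have [aplop _ _] := compat.
have [aplA aplB _ _ _ _] := anti_pre_lie_matched_op aplop.
by exists op; split=> //; split; [exact: matched_op_inl | exact: matched_op_inr].
Qed.

Lemma lie_matched_pair_manin_triple rhoA rhoB :
  (2 : K) != 0 -> anti_pre_lie opA -> anti_pre_lie opB ->
  lA - rA = rhoA -> lB - rB = rhoB ->
  lie_matched_pair (commutator opA) (commutator opB) rhoA rhoB ->
  exists br op0, [/\ lie_bracket br,
    double_summands br (commutator opA) (commutator opB),
    commutative_2cocycle br pairing_form,
    compatible_anti_pre_lie br pairing_form op0 &
    double_summands op0 opA opB].
Proof.
move=> two0 aplA aplB <- <- /matched_op_lie_bracket.
rewrite -commutator_matched_op => lie.
have [op0 [_ _ compat sub]] := double_manin_triple two0 lie.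
exists (commutator op), op0; split=> //; last exact: pairing_form_cocycle.
by rewrite commutator_matched_op; split;
  [exact: matched_op_inl | exact: matched_op_inr].
Qed.

End Double.

(** * Recovering the operations from a cocycle *)

Section Cocycle.
Variables (brA opA : bilop A) (brB opB : bilop B) (br : bilop (A * B)%type).
Hypothesis cocycle_br : commutative_2cocycle br pairing_form.
Hypothesis lie_br : lie_bracket br.
Hypothesis br_sub : double_summands br brA brB.
Hypothesis opAE :
  forall x c y, pair c (opA x y) = pair (br (x, 0) (0, c)).2 y.
Hypothesis opBE :
  forall a b x, pair (opB a b) x = pair b (br (0, a) (x, 0)).1.

Let br_skew u v : br u v = - br v u.
Proof. by apply/eqP; rewrite -addr_eq0 lie_bracket_skew. Qed.

(** The cocycle condition at [x], [y], [c] expresses the pairing of [c] with [[x, y]] through the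
    brackets of [x] and [y] with [c], which [opAE] turns into [opA x y] and [opA y x]. *)
Lemma cocycle_commutatorl : commutator opA = brA.
Proof.
have [_ _ cyc] := cocycle_br; apply/lfunP => x; apply/lfunP => y.
apply/esym/subr0_eq/pair_sepr => c; have := cyc (x, 0) (y, 0) (0, c).
rewrite -br_sub.1 (br_skew (0, c)) /pairing_form /= !(pair0l, pair0r).
rewrite commutatorE !(pairDr, pairNr, pairNl) !opAE => E.
by apply: (subr_eq_trans E); ring.
Qed.

Lemma cocycle_commutatorr : commutator opB = brB.
Proof.
have [_ _ cyc] := cocycle_br; apply/lfunP => a; apply/lfunP => b.
apply/esym/subr0_eq/pair_sepl => x; have := cyc (0, a) (0, b) (x, 0).
rewrite -br_sub.2 (br_skew (x, 0)) /pairing_form /= !(pair0l, pair0r).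
rewrite commutatorE !(pairDl, pairNl, pairNr) !opBE => E.
by apply: (subr_eq_trans E); ring.
Qed.

End Cocycle.

(** For [dual A] these adjoints are the opposites of [dual_rep] and [dual_rep_on_dual]. *)
Hypothesis adjointl : forall (W : vectType K) (rho : 'Hom(W, 'End(A))),
  exists sigma : 'Hom(W, 'End(B)),
    forall w b x, pair (sigma w b) x = pair b (rho w x).
Hypothesis adjointr : forall (W : vectType K) (rho : 'Hom(W, 'End(B))),
  exists sigma : 'Hom(W, 'End(A)),
    forall w x b, pair b (sigma w x) = pair (rho w b) x.

Lemma cocycle_anti_pre_lie (brA : bilop A) (brB : bilop B) br :
  (2 : K) != 0 -> lie_bracket br -> commutative_2cocycle br pairing_form ->
  double_summands br brA brB ->
  exists opA opB op0, [/\ anti_pre_lie opA /\ anti_pre_lie opB,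
    commutator opA = brA, commutator opB = brB,
    compatible_anti_pre_lie br pairing_form op0 &
    double_summands op0 opA opB].
Proof.
move=> two0 lie cocycle br_sub.
pose rho := bilin (fun x c => (br (x, 0) (0, c)).2).
have rhoE x c : rho x c = (br (x, 0) (0, c)).2.
  rewrite /rho bilinE // => z k u v /=.
    have -> : (k *: u + v, 0) = k *: (u, 0) + (v, 0) :> A * B.
      by apply: injective_projections; rewrite /= ?scaler0 ?addr0.
    by rewrite linearP add_lfunE scale_lfunE.
  have -> : (0, k *: u + v) = k *: (0, u) + (0, v) :> A * B.
    by apply: injective_projections; rewrite /= ?scaler0 ?addr0.
  by rewrite linearP.
pose sigma := bilin (fun a x => (br (0, a) (x, 0)).1).
have sigmaE a x : sigma a x = (br (0, a) (x, 0)).1.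
  rewrite /sigma bilinE // => z k u v /=.
    have -> : (0, k *: u + v) = k *: (0, u) + (0, v) :> A * B.
      by apply: injective_projections; rewrite /= ?scaler0 ?addr0.
    by rewrite linearP add_lfunE scale_lfunE.
  have -> : (k *: u + v, 0) = k *: (u, 0) + (v, 0) :> A * B.
    by apply: injective_projections; rewrite /= ?scaler0 ?addr0.
  by rewrite linearP.
(* Invariance prescribes this choice: left multiplications are adjoint to the mixed components of
   the bracket. *)
have [opA opAE] := adjointr rho; have [opB opBE] := adjointl sigma.
have EA x c y : pair c (opA x y) = pair (br (x, 0) (0, c)).2 y.
  by rewrite opAE rhoE.
have EB a b x : pair (opB a b) x = pair b (br (0, a) (x, 0)).1.
  by rewrite opBE sigmaE.
have commA := cocycle_commutatorl cocycle lie br_sub EA.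
have commB := cocycle_commutatorr cocycle lie br_sub EB.
have [lA lAE] := adjointl (commutator opA).
have [rA rAE] := adjointl (- Rmul opA).
have [lB lBE] := adjointr (commutator opB).
have [rB rBE] := adjointr (- Rmul opB).
have rAE' x b y : pair (rA x b) y = - pair b (opA y x).
  by rewrite rAE !opp_lfunE RmulE pairNr.
have rBE' a x c : pair c (rB a x) = - pair (opB c a) x.
  by rewrite rBE !opp_lfunE RmulE pairNl.
have lBE' a x c : pair c (lB a x) = pair (commutator opB a c) x by rewrite lBE.
(* Since [br] is a Lie bracket, this identification makes the double operation anti-pre-Lie, and
   hence [opA] and [opB]. *)
have def_br : br = commutator (matched_op opA opB lA rA lB rB).
  by apply: double_bracket_unique => //; rewrite ?commA ?commB.
have [|op0 [aplA aplB compat sub]] := double_manin_triple lAE rAE' lBE' rBE' two0.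
  by rewrite -def_br.
by rewrite -def_br in compat; exists opA, opB, op0.
Qed.

End Pairing.

(** * The evaluation pairing *)

Section DualDouble.
Variables (K : fieldType) (A : vectType K).

Definition eval_pairing (a : dual A) (x : A) : K := a x.

Lemma eval_pairing_bilinear : bilinear_for *%R *%R eval_pairing.
Proof.
split=> w k u v; rewrite /eval_pairing; first by rewrite add_lfunE scale_lfunE.
by rewrite linearP.
Qed.

Lemma eval_pairing_sepl b : (forall x, eval_pairing b x = 0) -> b = 0.
Proof. by move=> b0; apply/lfunP => x; rewrite zero_lfunE; apply: b0. Qed.

Lemma eval_pairing_sepr x : (forall b, eval_pairing b x = 0) -> x = 0.
Proof. exact: dual_sep. Qed.

Lemma eval_pairing_adjointl (W : vectType K) (rho : 'Hom(W, 'End(A))) :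
  exists sigma : 'Hom(W, 'End(dual A)),
    forall w b x, eval_pairing (sigma w b) x = eval_pairing b (rho w x).
Proof. exists (- dual_rep rho); exact: opp_dual_repE. Qed.

Lemma eval_pairing_adjointr (W : vectType K) (rho : 'Hom(W, 'End(dual A))) :
  exists sigma : 'Hom(W, 'End(A)),
    forall w x b, eval_pairing b (sigma w x) = eval_pairing (rho w b) x.
Proof. exists (- dual_rep_on_dual rho); exact: opp_dual_rep_on_dualE. Qed.

Section Ops.
Variables (opA : bilop A) (opD : bilop (dual A)).

Lemma opp_dual_rep_commutatorE x b y :
  eval_pairing ((- dual_rep (commutator opA)) x b) y
  = eval_pairing b (commutator opA x y).
Proof. exact: opp_dual_repE. Qed.

Lemma dual_rep_RmulE x b y :
  eval_pairing (dual_rep (Rmul opA) x b) y = - eval_pairing b (opA y x).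
Proof. by rewrite /eval_pairing dual_repE RmulE. Qed.

Lemma opp_dual_rep_on_dual_commutatorE a x c :
  eval_pairing c ((- dual_rep_on_dual (commutator opD)) a x)
  = eval_pairing (commutator opD a c) x.
Proof. exact: opp_dual_rep_on_dualE. Qed.

Lemma dual_rep_on_dual_RmulE a x c :
  eval_pairing c (dual_rep_on_dual (Rmul opD) a x) = - eval_pairing (opD c a) x.
Proof. by rewrite /eval_pairing dual_rep_on_dualE RmulE. Qed.

(** Dualises ad + R = L: the difference of the two actions in (2) is the action in (3). *)
Lemma dual_rep_LmulE :
  - dual_rep (commutator opA) - dual_rep (Rmul opA) = - dual_rep (Lmul opA).
Proof. by apply: subr_opp_dual_rep; rewrite subrK. Qed.

Lemma dual_rep_on_dual_LmulE :
  - dual_rep_on_dual (commutator opD) - dual_rep_on_dual (Rmul opD)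
  = - dual_rep_on_dual (Lmul opD).
Proof. by apply: subr_opp_dual_rep_on_dual; rewrite subrK. Qed.

End Ops.
End DualDouble.

(** * The equivalence and its converse for Manin triples *)

Lemma pchar0_two_neq0 (K : fieldType) : [pchar K] =i pred0 -> (2 : K) != 0.
Proof. by move/pcharf0P => ->. Qed.

Theorem theorem2p10 (K : closedFieldType) (charK0 : [pchar K] =i pred0)
    (A : vectType K) :
  (forall (opA : bilop A) (opD : bilop (dual A)),
     anti_pre_lie opA -> anti_pre_lie opD ->
     [<-> exists brD : bilop (A * dual A)%type,
            anti_pre_lie_manin_triple opA opD brD;
          apl_matched_pair opA opD
            (- dual_rep (commutator opA)) (dual_rep (Rmul opA))
            (- dual_rep_on_dual (commutator opD))
            (dual_rep_on_dual (Rmul opD));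
          lie_matched_pair (commutator opA) (commutator opD)
            (- dual_rep (Lmul opA)) (- dual_rep_on_dual (Lmul opD))]) /\
  (forall (brA : bilop A) (brA' : bilop (dual A)) (brD : bilop (A * dual A)%type),
     manin_triple brA brA' brD ->
     exists (opA : bilop A) (opD : bilop (dual A)),
       [/\ anti_pre_lie opA, anti_pre_lie opD,
           commutator opA = brA, commutator opD = brA' &
           anti_pre_lie_manin_triple opA opD brD]).
Proof.
have two0 := pchar0_two_neq0 charK0.
split=> [opA opD aplA aplD|brA brA' brD].
  tfae.
  - case=> brD [mt [op0 [compat sub0]]].
    exact: (double_apl_matched_pair (@eval_pairing_bilinear K A)
      (@eval_pairing_sepl K A) (@eval_pairing_sepr K A)
      (opp_dual_rep_commutatorE opA) (dual_rep_RmulE opA)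
      (opp_dual_rep_on_dual_commutatorE opD) (dual_rep_on_dual_RmulE opD)
      compat (mt_lieD mt) (mt_sub mt) sub0).
  - move=> /apl_lie_matched_pair.
    by rewrite dual_rep_LmulE dual_rep_on_dual_LmulE.
  move=> lmp.
  have [br [op0 [lie sub cocycle compat sub0]]] :=
    lie_matched_pair_manin_triple (@eval_pairing_bilinear K A)
      (@eval_pairing_sepl K A) (@eval_pairing_sepr K A)
      (opp_dual_rep_commutatorE opA) (dual_rep_RmulE opA)
      (opp_dual_rep_on_dual_commutatorE opD) (dual_rep_on_dual_RmulE opD)
      two0 aplA aplD (dual_rep_LmulE opA) (dual_rep_on_dual_LmulE opD) lmp.
  exists br; split; last by exists op0; exact: (conj compat sub0).
  exact: (Build_manin_triple (anti_pre_lie_lie_bracket aplA)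
    (anti_pre_lie_lie_bracket aplD) lie sub cocycle).
case=> lieA lieD lie sub cocycle.
have [opA [opD [op0 [[aplA aplD] commA commD compat sub0]]]] :=
  cocycle_anti_pre_lie (@eval_pairing_bilinear K A) (@eval_pairing_sepl K A)
    (@eval_pairing_sepr K A) (@eval_pairing_adjointl K A)
    (@eval_pairing_adjointr K A) two0 lie cocycle sub.
exists opA, opD; split=> //; rewrite /anti_pre_lie_manin_triple commA commD.
split; first exact: (Build_manin_triple lieA lieD lie sub cocycle).
by exists op0; exact: (conj compat sub0).
Qed.
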